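(* Let $\mathcal{V}$ be a variety of algebras of type $\Omega$, let $\mathcal{S}$ be a non-trivial subvariety of $\mathcal{S}_{\mathcal{V}}$, and let $X$ be a set. The $\mathcal{S}$-replica $(\mathcal{P}_{>0}^{<\omega}F_{\mathcal{V}}(X)/\Phi_{\mathcal{S}}(X),\Omega,\cup)$ of the algebra $(\mathcal{P}_{>0}^{<\omega}F_{\mathcal{V}}(X),\Omega,\cup)$ is free over $X$ in the variety $\mathcal{S}\subseteq\mathcal{S}_{\mathcal{V}}$ (with $x\in X$ identified with the class of $\{x\}$).
   Context: Fix a finitary type $\tau\colon\Omega\to\mathbb{N}^+$ (all operations have positive arity; $\Omega$ may be infinite). $(F_{\mathcal{V}}(X),\Omega)$ is the free algebra over $X$ in $\mathcal{V}$. A semilattice ordered $\mathcal{V}$-algebra is an algebra $(A,\Omega,+)$ with $(A,\Omega)\in\mathcal{V}$, $(A,+)$ a (join) semilattice, and each $\omega\in\Omega$ distributing over $+$ in each argument: $\omega(x_1,\ldots,x_i+y_i,\ldots,x_n)=\omega(x_1,\ldots,x_i,\ldots,x_n)+\omega(x_1,\ldots,y_i,\ldots,x_n)$. $\mathcal{S}_{\mathcal{V}}$ is the variety of all semilattice ordered $\mathcal{V}$-algebras. $\mathcal{P}_{>0}^{<\omega}B$ is the set of all finite non-empty subsets of $B$, with complex operations $\omega(B_1,\ldots,B_n)=\{\omega(b_1,\ldots,b_n)\mid b_i\in B_i\}$ and set union $\cup$. The $\mathcal{S}$-replica congruence of $(\mathcal{P}_{>0}^{<\omega}F_{\mathcal{V}}(X),\Omega,\cup)$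 is $\Phi_{\mathcal{S}}(X)=\bigcap\{\phi\mid\phi$ is a congruence of $(\mathcal{P}_{>0}^{<\omega}F_{\mathcal{V}}(X),\Omega,\cup)$ with $(\mathcal{P}_{>0}^{<\omega}F_{\mathcal{V}}(X)/\phi,\Omega,\cup)\in\mathcal{S}\}$, and the quotient by it is called the $\mathcal{S}$-replica. *)

(* Defs.v *)
From HB Require Import structures.
From mathcomp Require Import all_boot.
From mathcomp Require Import boolp classical_sets functions cardinality.

Set Implicit Arguments.
Unset Strict Implicit.
Unset Printing Implicit Defensive.

Local Open Scope classical_set_scope.
Local Open Scope quotient_scope.

Record signature := Signature {
  symb : Type;
  arity : symb -> nat;
  arity_gt0 : forall w, 0 < arity w }.

(* Carriers may be empty; as there are no nullary symbols, the empty algebra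
   satisfies every identity. *)
Record algebra (sg : signature) := Algebra {
  carrier :> Type;
  app : forall w : symb sg, ('I_(arity w) -> carrier) -> carrier }.

Definition is_hom (sg : signature) (A B : algebra sg) (h : A -> B) : Prop :=
  forall (w : symb sg) (x : 'I_(arity w) -> A),
    h (app x) = app (fun i => h (x i)).

Inductive term (sg : signature) (X : Type) : Type :=
| Var of X
| App (w : symb sg) of ('I_(arity w) -> term sg X).

Fixpoint eval (sg : signature) (X : Type) (A : algebra sg) (v : X -> A)
    (t : term sg X) : A :=
  match t with
  | Var x => v x
  | App w ts => app (fun i => eval v (ts i))
  end.

Definition is_variety (sg : signature) (V : algebra sg -> Prop) : Prop :=
  exists E : term sg nat -> term sg nat -> Prop, forall A : algebra sg,
    V A <-> (forall s t, E s t -> forall v : nat -> A, eval v s = eval v t).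

Definition nontrivial (sg : signature) (V : algebra sg -> Prop) : Prop :=
  exists A : algebra sg, V A /\ exists a b : A, a <> b.

(* Injectivity of eta is not part of the definition: it fails when V is
   trivial and X has more than one element. *)
Definition is_free (sg : signature) (V : algebra sg -> Prop) (X : Type)
    (F : algebra sg) (eta : X -> F) : Prop :=
  V F /\ forall A : algebra sg, V A -> forall f : X -> A,
    exists! h : F -> A, is_hom h /\ forall x, h (eta x) = f x.

Record congruence (sg : signature) (A : algebra sg) := Congruence {
  crel :> A -> A -> Prop;
  crel_refl : forall a, crel a a;
  crel_sym : forall a b, crel a b -> crel b a;
  crel_trans : forall a b c, crel a b -> crel b c -> crel a c;
  crel_app : forall (w : symb sg) (x y : 'I_(arity w) -> A),
    (forall i, crel (x i) (y i)) -> crel (app x) (app y) }.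

Section Quotient.
Variables (sg : signature) (A : algebra sg) (phi : congruence A).

Definition crelb : rel {classic A} := fun a b => `[< phi a b >].

Lemma crelb_refl : reflexive crelb.
Proof. by move=> a; apply/asboolP; apply: crel_refl. Qed.

Lemma crelb_sym : symmetric crelb.
Proof. by move=> a b; apply/asboolP/asboolP; apply: crel_sym. Qed.

Lemma crelb_trans : transitive crelb.
Proof.
by move=> b a c /asboolP ab /asboolP bc; apply/asboolP; apply: crel_trans bc.
Qed.

Canonical crel_equiv := EquivRel crelb crelb_refl crelb_sym crelb_trans.

Definition quot_carrier : Type := {eq_quot crel_equiv}.

Definition quot_pi (a : A) : quot_carrier :=
  \pi_({eq_quot crel_equiv}) (a : {classic A}).

Definition quot_app (w : symb sg) (x : 'I_(arity w) -> quot_carrier) :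
    quot_carrier :=
  quot_pi (app (fun i => repr (x i : {eq_quot crel_equiv}) : A)).

Definition quotient : algebra sg := Algebra quot_app.

Lemma quot_piP (a b : A) : quot_pi a = quot_pi b <-> phi a b.
Proof.
split=> [/eqmodP/asboolP //|ab].
by apply/eqmodP/asboolP.
Qed.

Lemma quot_pi_surj (c : quotient) : exists a, quot_pi a = c.
Proof.
by exists (repr (c : {eq_quot crel_equiv}) : A); rewrite /quot_pi; apply: reprK.
Qed.

Lemma quot_pi_hom : @is_hom sg A quotient quot_pi.
Proof.
move=> w x; apply/quot_piP; apply: crel_app => i.
apply/quot_piP; rewrite /quot_pi; symmetry; exact: reprK.
Qed.

End Quotient.

Section Replica.
Variables (sg : signature) (S : algebra sg -> Prop) (A : algebra sg).

Definition replica_rel (a b : A) : Prop :=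
  forall phi : congruence A, S (quotient phi) -> phi a b.

Lemma replica_rel_refl a : replica_rel a a.
Proof. by move=> phi _; apply: crel_refl. Qed.

Lemma replica_rel_sym a b : replica_rel a b -> replica_rel b a.
Proof. by move=> ab phi /ab; apply: crel_sym. Qed.

Lemma replica_rel_trans a b c :
  replica_rel a b -> replica_rel b c -> replica_rel a c.
Proof.
by move=> ab bc phi Sphi; apply: crel_trans (ab _ Sphi) (bc _ Sphi).
Qed.

Lemma replica_rel_app (w : symb sg) (x y : 'I_(arity w) -> A) :
  (forall i, replica_rel (x i) (y i)) -> replica_rel (app x) (app y).
Proof. by move=> xy phi Sphi; apply: crel_app => i; apply: xy. Qed.

Definition replica_congruence : congruence A :=
  Congruence replica_rel_refl replica_rel_sym replica_rel_trans replica_rel_app.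

Definition replica : algebra sg := quotient replica_congruence.

End Replica.

(* The type of (A, Omega, +): None is the binary symbol +. *)
Section PlusSignature.
Variable sg : signature.

Definition plus_arity (o : option (symb sg)) : nat :=
  if o is Some w then arity w else 2.

Lemma plus_arity_gt0 o : 0 < plus_arity o.
Proof. by case: o => [w|] //=; apply: arity_gt0. Qed.

Definition plus_sig : signature := Signature plus_arity_gt0.

Definition reduct (A : algebra plus_sig) : algebra sg :=
  @Algebra sg A (fun w x => @app plus_sig A (Some w) x).

Definition plus (A : algebra plus_sig) (a b : A) : A :=
  @app plus_sig A None (fun i : 'I_2 => if i == ord0 then a else b).

Definition is_semilattice (A : algebra plus_sig) : Prop :=
  [/\ forall a b c : A, plus a (plus b c) = plus (plus a b) c,
      forall a b : A, plus a b = plus b a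
    & forall a : A, plus a a = a].

Definition update (T : Type) (n : nat) (x : 'I_n -> T) (i : 'I_n) (a : T) :
    'I_n -> T :=
  fun j => if j == i then a else x j.

Definition distributes (A : algebra plus_sig) : Prop :=
  forall (w : symb sg) (x : 'I_(arity w) -> A) (i : 'I_(arity w)) (a b : A),
    let f := @app sg (reduct A) w in
    f (update x i (plus a b)) = plus (f (update x i a)) (f (update x i b)).

Definition semilattice_ordered (V : algebra sg -> Prop)
    (A : algebra plus_sig) : Prop :=
  [/\ V (reduct A), is_semilattice A & distributes A].

End PlusSignature.

Record fin_subset (T : Type) := FinSubset {
  fs_set :> set T;
  fs_finite : finite_set fs_set;
  fs_nonempty : fs_set !=set0 }.

Definition fs1 (T : Type) (a : T) : fin_subset T :=
  FinSubset (finite_set1 a) (ex_intro [set a] a (erefl a)).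

Lemma fsU_finite (T : Type) (B C : fin_subset T) : finite_set (B `|` C).
Proof. by rewrite finite_setU; split; apply: fs_finite. Qed.

Lemma fsU_nonempty (T : Type) (B C : fin_subset T) : (B `|` C) !=set0.
Proof. by have [b Bb] := fs_nonempty B; exists b; left. Qed.

Definition fsU (T : Type) (B C : fin_subset T) : fin_subset T :=
  FinSubset (fsU_finite B C) (fsU_nonempty B C).

Section PowerAlgebra.
Variables (sg : signature) (A : algebra sg).

Definition complex_app (w : symb sg) (B : 'I_(arity w) -> set A) : set A :=
  [set app b | b in [set b : 'I_(arity w) -> A | forall i, B i (b i)]].

Lemma complex_app_finite (w : symb sg) (B : 'I_(arity w) -> fin_subset A) :
  finite_set (complex_app B).
Proof.
apply: finite_image.
have /choice [s sP] (i : 'I_(arity w)) :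
    exists s : seq {classic A}, forall a, fs_set (B i) a -> a \in s.
  have /(@finite_seqP {classic A}) [s Bs] := fs_finite (B i).
  by exists s => a; rewrite Bs.
pose g (f : {dffun forall i, seq_sub (s i)}) : 'I_(arity w) -> A :=
  fun i => ssval (f i).
apply: (@sub_finite_set _ _ (g @` setT)); last first.
  by apply: finite_image; apply: finite_finset.
move=> b Bb; exists [ffun i => SeqSub (sP i _ (Bb i))] => //.
by apply: funext => i; rewrite /g ffunE.
Qed.

Lemma complex_app_nonempty (w : symb sg) (B : 'I_(arity w) -> fin_subset A) :
  complex_app B !=set0.
Proof.
have /choice [b Bb] : forall i, exists a, fs_set (B i) a.
  by move=> i; apply: fs_nonempty.
by exists (app b), b.
Qed.

Definition complex_fs (w : symb sg) (B : 'I_(arity w) -> fin_subset A) :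
    fin_subset A :=
  FinSubset (complex_app_finite B) (complex_app_nonempty B).

Definition power_app (o : symb (plus_sig sg)) :
    ('I_(arity o) -> fin_subset A) -> fin_subset A :=
  match o with
  | Some w => fun B => @complex_fs w B
  | None => fun B : 'I_2 -> fin_subset A => fsU (B ord0) (B ord_max)
  end.

Definition power_algebra : algebra (plus_sig sg) := Algebra power_app.

End PowerAlgebra.

(* Main.v *)
Require Import Defs.
From mathcomp Require Import all_boot.
From mathcomp Require Import boolp classical_sets functions cardinality.

(** The replica of any algebra [A] in a variety [S] lies in [S] and is the
    universal [S]-quotient of [A]: an identity of [S] holds modulo each of the
    congruences whose intersection defines the replica, hence modulo the
    intersection, and a homomorphism from [A] to a member of [S] factors through
    the replica because its image, being a subalgebra, lies in [S] ([replica_in_variety], [replica_lift]).  It thus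
    suffices to see how homomorphisms out of the power algebra of [F] to a
    semilattice ordered algebra [A] are determined by their values on the
    singletons of generators.

    Existence.  A map [f : X -> A] extends to a homomorphism [h] from [F] to the
    reduct of [A], and [h] extends to finite non-empty subsets by
    [B |-> join of h @` B].  This map preserves unions for trivial reasons, and
    the operations of the power algebra because the operations of [A] distribute
    over finite joins in all arguments together ([is_join_app]).

    Uniqueness.  Singletons form a copy of [F] inside the power algebra, so
    freeness of [F] determines a homomorphism on all singletons; every finite
    non-empty set is a finite union of singletons, and union is an operation.

    Injectivity of [x |-> class of {x}] follows from the extension property: a
    non-trivial member of [S] receives maps from [X] separating any two
    points. *)

Set Implicit Arguments.
Unset Strict Implicit.
Unset Printing Implicit Defensive.

Local Open Scope classical_set_scope.

(** * Varieties, quotients and replicas *)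

Section Varieties.
Variable sg : signature.

Lemma hom_comp (A B C : algebra sg) (g : B -> C) (h : A -> B) :
  is_hom g -> is_hom h -> is_hom (g \o h).
Proof. by move=> g_hom h_hom w x /=; rewrite h_hom g_hom. Qed.

Lemma hom_eval (X : Type) (A B : algebra sg) (h : A -> B) (v : X -> A)
    (t : term sg X) :
  is_hom h -> h (eval v t) = eval (h \o v) t.
Proof.
move=> h_hom; elim: t => [//|w ts IH] /=.
by rewrite h_hom; congr app; apply: funext.
Qed.

Lemma variety_embedding (V : algebra sg -> Prop) (A B : algebra sg)
    (h : A -> B) :
  is_variety V -> is_hom h -> injective h -> V B -> V A.
Proof.
move=> [E VE] h_hom h_inj /VE EB; apply/VE => s t st v.
by apply: h_inj; rewrite !hom_eval //; apply: EB.
Qed.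

Lemma quot_lift_family (A : algebra sg) (phi : congruence A) (I : Type)
    (c : I -> quotient phi) :
  exists a : I -> A, c = quot_pi phi \o a.
Proof.
have /choice[a ac] i := quot_pi_surj (c i).
by exists a; apply: funext => i /=; rewrite ac.
Qed.

Lemma quotient_factor (A B : algebra sg) (phi : congruence A) (h : A -> B) :
    is_hom h -> (forall a b, phi a b -> h a = h b) ->
  exists2 g : quotient phi -> B, is_hom g & forall a, g (quot_pi phi a) = h a.
Proof.
move=> h_hom phi_h.
have /choice[r rK] := @quot_pi_surj _ _ phi.
have gE a : h (r (quot_pi phi a)) = h a by apply/phi_h/quot_piP; rewrite rK.
exists (h \o r) => // w c; have [a ->] := quot_lift_family c.
have /= <- := quot_pi_hom phi a.
by rewrite gE h_hom; congr app; apply: funext => i /=; rewrite gE.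
Qed.

Section Kernel.
Variables (A B : algebra sg) (h : A -> B) (h_hom : is_hom h).

Lemma ker_app (w : symb sg) (x y : 'I_(arity w) -> A) :
  (forall i, h (x i) = h (y i)) -> h (app x) = h (app y).
Proof. by move=> xy; rewrite !h_hom; congr app; apply: funext. Qed.

Definition hom_kernel : congruence A :=
  @Congruence _ A (fun a b => h a = h b) (fun=> erefl)
    (fun _ _ => @esym _ _ _) (fun _ _ _ => @etrans _ _ _ _) ker_app.

Lemma variety_kernel_quotient (V : algebra sg -> Prop) :
  is_variety V -> V B -> V (quotient hom_kernel).
Proof.
move=> V_variety VB.
have [//|g g_hom gE] := @quotient_factor _ _ hom_kernel h h_hom.
apply: (variety_embedding V_variety g_hom _ VB) => c d.
have [a <-] := quot_pi_surj c; have [b <-] := quot_pi_surj d.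
by rewrite !gE => hab; apply/quot_piP.
Qed.

End Kernel.

(** Two terms identified by [S] have replica-related values in [A], because
    their values are identified in each quotient of [A] that lies in [S]. *)
Lemma replica_in_variety (S : algebra sg -> Prop) (A : algebra sg) :
  is_variety S -> S (replica S A).
Proof.
move=> [E SE]; apply/SE => s t st v; have [a ->] := quot_lift_family v.
rewrite -!(hom_eval _ _ (@quot_pi_hom _ _ _)); apply/quot_piP => phi Sphi.
apply/quot_piP; rewrite !(hom_eval _ _ (@quot_pi_hom _ _ phi)).
by move/SE: Sphi; apply.
Qed.

(** The kernel of [h] is one of the congruences whose intersection defines the
    replica. *)
Lemma replica_lift (S : algebra sg -> Prop) (A B : algebra sg) (h : A -> B) :
    is_variety S -> S B -> is_hom h ->
  exists2 g : replica S A -> B, is_hom g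
    & forall a, g (quot_pi (replica_congruence S A) a) = h a.
Proof.
move=> S_variety SB h_hom; apply: quotient_factor => // a b ab.
exact: (ab _ (variety_kernel_quotient h_hom S_variety SB)).
Qed.

End Varieties.

(** * Finite non-empty subsets *)

Lemma fin_subset_eq (T : Type) (B C : fin_subset T) :
  fs_set B = fs_set C -> B = C.
Proof.
case: B C => [B Bfin B0] [C Cfin C0] /= BC; rewrite -{}BC in Cfin C0 *.
by rewrite (Prop_irrelevance Bfin Cfin) (Prop_irrelevance B0 C0).
Qed.

Lemma fin_subset_ind (T : Type) (P : fin_subset T -> Prop) :
    (forall a, P (fs1 a)) -> (forall B C, P B -> P C -> P (fsU B C)) ->
  forall B, P B.
Proof.
move=> P1 PU B; have /(@finite_seqP {classic T})[s Bs] := fs_finite B.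
case: s Bs => [|a s] Bs.
  by have [b] := fs_nonempty B; rewrite Bs.
elim: s a B Bs => [|b s IH] a B Bs.
  suff -> : B = fs1 a by [].
  by apply: fin_subset_eq; rewrite Bs set_cons1.
have Cfin : finite_set ([set` b :: s] : set {classic T}).
  exact: finite_seq.
have C0 : ([set` b :: s] : set {classic T}) !=set0.
  by exists b; rewrite /= mem_head.
pose C : fin_subset T := FinSubset Cfin C0.
suff -> : B = fsU (fs1 a) C by apply: PU => //; apply: (IH b).
apply: fin_subset_eq; rewrite Bs; apply/seteqP.
by split=> x /=; rewrite in_cons => /predU1P.
Qed.

(** * Finite joins in semilattice ordered algebras *)

(** Turns a property of operations in one argument at a time, such as
    distributivity, into a property in all arguments together: the coordinates
    of a point of the product of the [D i] are replaced from left to right by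
    those of [j]. *)
Lemma update_ind (T : Type) (n : nat) (D : 'I_n -> set T) (j : 'I_n -> T)
    (Q : ('I_n -> T) -> Prop) :
    (forall x, (forall i, D i (x i)) -> Q x) ->
    (forall x i, (forall a, D i a -> Q (update x i a)) ->
      Q (update x i (j i))) ->
  Q j.
Proof.
move=> Q_base Q_step.
suff Q_upto k : k <= n -> forall x, (forall i : 'I_n, i < k -> x i = j i) ->
    (forall i : 'I_n, k <= i -> D i (x i)) -> Q x.
  by apply: (Q_upto n) => // i; rewrite leqNgt ltn_ord.
elim: k => [_ x _ Dx|k IH ltkn x xj Dx]; first by apply: Q_base => i; apply: Dx.
pose i := Ordinal ltkn.
have -> : x = update x i (j i).
  by apply: funext => l; rewrite /update; case: eqP => // ->; apply: xj.
apply: Q_step => a Da; apply: (IH (ltnW ltkn)) => l lk.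
  rewrite /update; case: eqP lk => [->|_ lk]; first by rewrite ltnn.
  exact/xj/ltnW.
rewrite /update; case: eqP => [->//|/eqP li]; apply: Dx.
by rewrite ltn_neqAle lk andbT eq_sym.
Qed.

Section Joins.
Variables (sg : signature) (A : algebra (plus_sig sg)).

Lemma app_NoneE (x : 'I_2 -> A) :
  @app (plus_sig sg) A None x = plus (x ord0) (x ord_max).
Proof.
congr app; apply: funext => i; case: eqP => [->//|/eqP i0].
by congr x; apply: val_inj => /=; case: i i0 => -[|[]].
Qed.

Definition plus_closed (Q : set A) : Prop :=
  forall a b, Q a -> Q b -> Q (plus a b).

(** The second clause, membership in the subsemilattice generated by [D],
    replaces being the least upper bound: it implies leastness, since principal
    ideals are closed under [plus], and unlike leastness it is preserved by
    every map that preserves binary joins, which is how distributivity in one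
    argument extends to finite joins. *)
Definition is_join (D : set A) (j : A) : Prop :=
  (forall a, D a -> plus a j = j) /\
  (forall Q : set A, plus_closed Q -> D `<=` Q -> Q j).

Hypothesis A_lat : is_semilattice A.

Let plusA (a b c : A) : plus a (plus b c) = plus (plus a b) c.
Proof. by case: A_lat. Qed.

Let plusC (a b : A) : plus a b = plus b a.
Proof. by case: A_lat. Qed.

Let plusxx (a : A) : plus a a = a.
Proof. by case: A_lat. Qed.

Lemma plus_closed_ideal (c : A) : plus_closed [set a | plus a c = c].
Proof. by move=> a b /= ac bc; rewrite -plusA bc. Qed.

Lemma is_join_unique (D : set A) (j k : A) :
  is_join D j -> is_join D k -> j = k.
Proof.
move=> [Dj jmin] [Dk kmin].
have jk : plus j k = k by apply: (jmin _ (@plus_closed_ideal k)).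
by rewrite -jk plusC; symmetry; apply: (kmin _ (@plus_closed_ideal j)).
Qed.

Lemma is_join1 (a : A) : is_join [set a] a.
Proof. by split=> [_ ->|Q _]; [apply: plusxx | apply]. Qed.

Lemma is_joinU (D E : set A) (j k : A) :
  is_join D j -> is_join E k -> is_join (D `|` E) (plus j k).
Proof.
move=> [Dj jmin] [Ek kmin]; split=> [a [Da|Ea]|Q Q_closed].
- by rewrite plusA Dj.
- by rewrite (plusC j) plusA Ek.
- rewrite subUset => -[DQ EQ].
  exact: Q_closed (jmin Q Q_closed DQ) (kmin Q Q_closed EQ).
Qed.

Lemma is_join_exists (T : Type) (h : T -> A) (B : fin_subset T) :
  exists j, is_join (h @` B) j.
Proof.
elim/fin_subset_ind: B => [a|B C [j Bj] [k Ck]].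
  by exists (h a); rewrite image_set1; apply: is_join1.
by exists (plus j k); rewrite image_setU; apply: is_joinU.
Qed.

Hypothesis A_distr : distributes A.

Let op (w : symb sg) := @app sg (reduct A) w.

Lemma op_monotone (w : symb sg) (x y : 'I_(arity w) -> A) :
  (forall i, plus (x i) (y i) = y i) -> plus (op x) (op y) = op y.
Proof.
move=> xy.
apply: (@update_ind _ _ (fun i => [set x i]) y
  (fun z => plus (op x) (op z) = op z)) => [z zx|z i /(_ _ erefl) IH].
  by rewrite (_ : z = x); [apply: plusxx|apply: funext].
by rewrite -(xy i) /op A_distr plusA IH.
Qed.

(** Distributivity over finite joins in all arguments together.  The elements
    whose substitution in one argument keeps the value in a given closed set
    form a closed set themselves, so the join of that argument is among them. *)
Lemma is_join_app (w : symb sg) (D : 'I_(arity w) -> set A)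
    (j : 'I_(arity w) -> A) :
    (forall i, is_join (D i) (j i)) ->
  is_join [set op x | x in [set x | forall i, D i (x i)]] (op j).
Proof.
move=> Dj; split=> [_ [x Dx <-]|Q Q_closed DQ].
  by apply: op_monotone => i; apply: (Dj i).1; apply: Dx.
apply: (@update_ind _ _ D j (fun x => Q (op x))) => [x Dx|x i IH].
  by apply: DQ; exists x.
apply: ((Dj i).2 [set a | Q (op (update x i a))]) => // a b /= Qa Qb.
by rewrite /op A_distr; apply: Q_closed.
Qed.

End Joins.

(** * Homomorphisms out of the power algebra *)

Section PowerHom.
Variables (sg : signature) (F : algebra sg) (A : algebra (plus_sig sg)).

Lemma power_extend (h : F -> reduct A) :
    is_semilattice A -> distributes A -> @is_hom sg F (reduct A) h ->
  exists2 H : power_algebra F -> A, is_hom H & forall a, H (fs1 a) = h a.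
Proof.
move=> A_lat A_distr h_hom.
have /choice[H HP] := is_join_exists A_lat (h : F -> A).
exists H; last first.
  move=> a; apply: (is_join_unique A_lat (HP _)).
  by rewrite image_set1; apply: is_join1.
move=> [w|] B; apply: (is_join_unique A_lat (HP _)).
  have -> : h @` power_app B =
      [set @app sg (reduct A) w x | x in
        [set x | forall i, (h @` B i) (x i)]].
    apply/seteqP; split=> [_ [_ [b Bb <-] <-]|_ [x Bx <-]].
      by exists (h \o b); [move=> i; exists (b i) | rewrite h_hom].
    have /choice[b bP] i : exists b, fs_set (B i) b /\ h b = x i.
      by have [b Bb bx] := Bx i; exists b.
    exists (@app sg F w b); first by exists b => // i; case: (bP i).
    by rewrite h_hom; congr app; apply: funext => i; case: (bP i).
  exact: (@is_join_app _ _ A_lat A_distr w _ (fun i => H (B i))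
    (fun i => HP (B i))).
rewrite (app_NoneE (fun i => H (B i))) /= image_setU.
exact: (is_joinU A_lat (HP _) (HP _)).
Qed.

Lemma fs1_app (w : symb sg) (x : 'I_(arity w) -> F) :
  fs1 (app x) = @app _ (power_algebra F) (Some w) (fun i => fs1 (x i)).
Proof.
apply: fin_subset_eq; apply/seteqP; split=> [_ ->|_ [b bx <-]] /=.
  by exists x.
by congr app; apply: funext.
Qed.

Lemma hom_fs1 (H : power_algebra F -> A) :
  is_hom H -> @is_hom sg F (reduct A) (fun a => H (fs1 a)).
Proof. by move=> H_hom w x; rewrite fs1_app H_hom. Qed.

Lemma power_hom_ext (G H : power_algebra F -> A) :
    is_hom G -> is_hom H -> (forall a, G (fs1 a) = H (fs1 a)) -> G = H.
Proof.
move=> G_hom H_hom GH; apply: funext; apply: fin_subset_ind => // B C GHB GHC.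
pose BC (i : 'I_2) : power_algebra F := if i == ord0 then B else C.
have -> : fsU B C = @app _ (power_algebra F) None BC by [].
by rewrite G_hom H_hom !app_NoneE /BC /= GHB GHC.
Qed.

End PowerHom.

(** * Freeness of the replica *)

Lemma free_injective (sg : signature) (S : algebra sg -> Prop) (X : Type)
    (F : algebra sg) (eta : X -> F) :
  nontrivial S -> is_free S eta -> injective eta.
Proof.
move=> [A [SA [a [b ab]]]] [_ F_ext] x y xy; apply: contrapT => nxy.
have [h [[_ hE] _]] := F_ext A SA (fun z => if `[< z = x >] then a else b).
apply: ab; have := hE y; rewrite -xy hE.
by rewrite (asboolT (erefl x)) asboolF => [//|/esym].
Qed.

Theorem theorem4p14 (sg : signature) (V : algebra sg -> Prop)
    (S : algebra (plus_sig sg) -> Prop) (X : Type)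
    (F : algebra sg) (eta : X -> F)
    (V_variety : is_variety V)
    (S_variety : is_variety S)
    (S_sub : forall A, S A -> semilattice_ordered V A)
    (S_nontrivial : nontrivial S)
    (F_free : is_free V eta) :
  let P := power_algebra F in
  let iota : X -> replica S P :=
    fun x => quot_pi (replica_congruence S P) (fs1 (eta x)) in
  injective iota /\ is_free S iota.
Proof.
move=> P iota.
suff iota_free : is_free S iota by split=> //; apply: free_injective iota_free.
split=> [|A SA f]; first exact: replica_in_variety.
have [VA A_lat A_distr] := S_sub A SA.
have [h [[h_hom hE] h_unique]] := F_free.2 (reduct A) VA f.
have [H H_hom HE] := power_extend A_lat A_distr h_hom.
have [g g_hom gE] := replica_lift S_variety SA H_hom.
exists g; split=> [|g' [g'_hom g'E]].
  by split=> // x; rewrite /iota gE HE hE.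
pose G' : P -> A := g' \o quot_pi (replica_congruence S P).
have G'_hom : is_hom G' by apply: hom_comp => //; apply: quot_pi_hom.
have HG' : H = G'.
  apply: power_hom_ext => // a; rewrite HE.
  by rewrite (h_unique _ (conj (hom_fs1 G'_hom) g'E)).
apply: funext => c; have [B <-] := quot_pi_surj c.
by rewrite gE HG'.
Qed.
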